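(* Let $H$ and $N$ be two subrings of a finite non-commutative ring $R$ such that $N$ is an ideal of $R$ and $N\subseteq H$. Then \[ \Pr(H,R)\le \Pr\left(\frac{H}{N},\frac{R}{N}\right)\Pr(N). \] The equality holds if $N\cap[H,R]=\{0\}$.
   Context: Rings are associative and are not required to have an identity; a subring is an additive subgroup closed under multiplication; an ideal is two-sided, and $R/N$ is the quotient ring, with $H/N$ its subring. For a subring $S$ of a finite ring $T$, $\Pr(S,T)=\dfrac{|\{(s,t)\in S\times T: st=ts\}|}{|S|\,|T|}$, and $\Pr(T)=\Pr(T,T)$. $[H,R]$ denotes the subgroup of $(R,+)$ generated by all additive commutators $[h,r]=hr-rh$ with $h\in H$, $r\in R$. *)

(* Defs.v *)
From HB Require Import structures.
From mathcomp Require Import all_boot all_order all_algebra all_fingroup.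
Set Implicit Arguments.
Unset Strict Implicit.
Unset Printing Implicit Defensive.
Import GRing.Theory.
Local Open Scope ring_scope.

(* MathComp rings are unital, hence this hierarchy of associative rings that  *)
(* are not required to have an identity.                                      *)
HB.mixin Record Zmodule_isRng R of GRing.Zmodule R := {
  rng_mul : R -> R -> R;
  rng_mulA : associative rng_mul;
  rng_mulDl : left_distributive rng_mul +%R;
  rng_mulDr : right_distributive rng_mul +%R
}.

#[short(type="rngType")]
HB.structure Definition Rng := {R of Zmodule_isRng R & GRing.Zmodule R}.

#[short(type="finRngType")]
HB.structure Definition FinRng := {R of Rng R & Finite R}.

Notation "x ** y" := (rng_mul x y) (at level 40, left associativity) : ring_scope.

Lemma rng_mulBl (R : rngType) (x y z : R) : (x - y) ** z = x ** z - y ** z.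
Proof. by apply/eqP; rewrite eq_sym subr_eq -rng_mulDl subrK. Qed.

Lemma rng_mulBr (R : rngType) (x y z : R) : x ** (y - z) = x ** y - x ** z.
Proof. by apply/eqP; rewrite eq_sym subr_eq -rng_mulDr subrK. Qed.

HB.mixin Record isRngMulClosed (R : rngType) (S : R -> bool) := {
  rng_memM : {in S &, forall x y, x ** y \in S}
}.

#[short(type="subrngClosed")]
HB.structure Definition SubrngClosed (R : rngType) :=
  {S of GRing.ZmodClosed R S & isRngMulClosed R S}.

HB.mixin Record isRngIdeal (R : rngType) (S : R -> bool) := {
  rng_idealMl : forall r : R, {in S, forall x, r ** x \in S};
  rng_idealMr : forall r : R, {in S, forall x, x ** r \in S}
}.

#[short(type="rngIdeal")]
HB.structure Definition RngIdeal (R : rngType) :=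
  {S of SubrngClosed R S & isRngIdeal R S}.

Section RngQuotient.

Local Open Scope quotient_scope.

Variables (R : rngType) (I : rngIdeal R).
Local Notation Q := (Quotient.quot I).

Definition rng_quot_mul : Q -> Q -> Q := lift_op2 Q (@rng_mul R).

Lemma pi_rng_mul : {morph \pi_Q : x y / x ** y >-> rng_quot_mul x y}.
Proof.
move=> x y; unlock rng_quot_mul; apply/eqP; rewrite -Quotient.idealrBE.
set x' := generic_quotient.repr (\pi_Q x).
set y' := generic_quotient.repr (\pi_Q y).
have -> : x ** y - x' ** y' = (x - x') ** y + x' ** (y - y').
  by rewrite rng_mulBl rng_mulBr addrA subrK.
by rewrite rpredD ?(rng_idealMr y) ?(rng_idealMl x') // Quotient.idealrBE reprK.
Qed.

Lemma rng_quot_mulA : associative rng_quot_mul.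
Proof.
move=> x y z; rewrite -[x]reprK -[y]reprK -[z]reprK.
by rewrite -!pi_rng_mul rng_mulA.
Qed.

Lemma rng_quot_mulDl : left_distributive rng_quot_mul +%R.
Proof.
move=> x y z; rewrite -[x]reprK -[y]reprK -[z]reprK.
by rewrite -!(raddfD, pi_rng_mul) rng_mulDl.
Qed.

Lemma rng_quot_mulDr : right_distributive rng_quot_mul +%R.
Proof.
move=> x y z; rewrite -[x]reprK -[y]reprK -[z]reprK.
by rewrite -!(raddfD, pi_rng_mul) rng_mulDr.
Qed.

HB.instance Definition _ := Zmodule_isRng.Build Q
  rng_quot_mulA rng_quot_mulDl rng_quot_mulDr.

End RngQuotient.

Section FinRngQuotient.

Variables (R : finRngType) (I : rngIdeal R).
Local Notation Q := (Quotient.quot I).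

(* Typed on Q itself, and not on the carrier of its quotType structure, so    *)
(* that the instances below are attached to Q.                                *)
Let quot_repr (x : Q) : R := generic_quotient.repr x.
Let quot_pi (x : R) : Q := (\pi_Q x)%qT.

Let quot_reprK : cancel quot_repr quot_pi.
Proof. exact: reprK. Qed.

HB.instance Definition _ :=
  isCountable.Build Q (pcan_pickleK (can_pcan quot_reprK)).
HB.instance Definition _ :=
  isFinite.Build Q (pcan_enumP (can_pcan quot_reprK)).

End FinRngQuotient.

(* The canonical group law of a finZmodType is its addition, so <<A>>%g is     *)
(* the additive subgroup generated by A.                                      *)
Definition zmod_gen (V : finZmodType) (A : {set V}) : {set V} := <<A>>%g.

Section Definitions.

Variable R : finRngType.
Implicit Types A B : {pred R}.

(* A and B range over subsets of an ambient rng, so that comm_prob B B is the *)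
(* commuting probability of the rng B when B is a subring of R.               *)
Definition comm_prob A B : rat :=
  #|[pred p : R * R | [&& p.1 \in A, p.2 \in B & p.1 ** p.2 == p.2 ** p.1]]|%:R
  / (#|A| * #|B|)%:R.

Definition rng_commutators A B : {set R} :=
  zmod_gen [set x ** y - y ** x | x in A, y in B].

Definition rng_quot_image (I : rngIdeal R) A : {set {ideal_quot I}} :=
  [set (\pi_{ideal_quot I} x)%qT | x in A].

End Definitions.

(* Main.v *)
Require Import Defs.
From HB Require Import structures.
From mathcomp Require Import all_boot all_order all_algebra all_fingroup.
Import GRing.Theory Num.Theory.
Local Open Scope ring_scope.

(** Sort the commuting pairs [(h, r)] of [H * R] by their cosets
    [(x, y) = (h + N, r + N)]. Only commuting pairs [(x, y)] of
    [H/N * R/N] occur, and the heart of the proof is that each of them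
    accounts for at most as many commuting pairs as [N * N] does
    ([leq_card_comm_pairs_coset]). Summing over [(x, y)] gives
    [c(H, R) <= c(H/N, R/N) c(N, N)] for the numbers [c] of commuting pairs,
    and dividing by [|H| |R| = (|H/N| |R/N|) (|N| |N|)] gives the inequality.

    The bound on one pair of cosets comes from replacing them by [N] one at a
    time. The elements of a coset that commute with a given [a] are either
    absent or a translate, by one of them, of the elements of [N] that commute
    with [a]. This is applied to [y] with [a] in [x], and then, as commuting is
    symmetric, to [x] with [a] in [N].

    If [N] meets [[H, R]] trivially, then for commuting [x] and [y] every
    commutator of [h] in [x] and [r] in [y] lies in both, hence vanishes. All
    [|N| |N|] pairs of [x * y] then commute; as [N * N] cannot have more
    commuting pairs than this, the bound is attained for every [(x, y)]. *)

Definition commutes {R : rngType} : rel R := fun x y => x ** y == y ** x.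

Lemma commutesC {R : rngType} (x y : R) : commutes x y = commutes y x.
Proof. exact: eq_sym. Qed.

Lemma commutesD {R : rngType} (a x y : R) :
  commutes a x -> commutes a (x + y) = commutes a y.
Proof.
by move=> /eqP ax; rewrite /commutes rng_mulDr rng_mulDl ax (inj_eq (addrI _)).
Qed.

Definition comm_pairs {R : finRngType} (A B : {pred R}) : pred (R * R) :=
  [pred p | [&& p.1 \in A, p.2 \in B & commutes p.1 p.2]].

Lemma card_comm_pairs (R : finRngType) (A B : {pred R}) :
  #|comm_pairs A B| = (\sum_(a in A) #|[pred b in B | commutes a b]|)%N.
Proof.
rewrite -sum1_card.
under [RHS]eq_bigr do rewrite -sum1_card.
rewrite pair_big_dep /=.
by apply: eq_bigl => -[a b].
Qed.

Lemma card_comm_pairsC (R : finRngType) (A B : {pred R}) :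
  #|comm_pairs A B| = #|comm_pairs B A|.
Proof.
rewrite -(card_image (f := fun p : R * R => (p.2, p.1))); last first.
  by move=> [a b] [c d] /= [-> ->].
apply: eq_card => -[a b]; apply/imageP/idP => /=.
  by move=> [[c d] /and3P [/= cA dB cd] [-> ->]]; rewrite !inE /= cA dB commutesC.
move=> /and3P [/= aB bA ab]; exists (b, a) => //.
by rewrite !inE /= aB bA commutesC.
Qed.

Lemma mem_zmod_gen (V : finZmodType) (A : {set V}) (v : V) :
  v \in A -> v \in zmod_gen A.
Proof. exact: mem_gen. Qed.

Section Coset.

Context {R : finRngType} (N : rngIdeal R).

Definition coset_class (x : {ideal_quot N}) : {pred R} :=
  [pred r | (\pi_{ideal_quot N} r)%qT == x].

Lemma coset_classE (r0 r : R) :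
  (r \in coset_class (\pi r0)%qT) = (r - r0 \in N).
Proof. by rewrite inE Quotient.idealrBE. Qed.

Lemma commutes_pi (x y : R) :
  commutes (\pi_{ideal_quot N} x)%qT (\pi_{ideal_quot N} y)%qT
  = (x ** y - y ** x \in N).
Proof. by rewrite Quotient.idealrBE !pi_rng_mul. Qed.

Lemma card_coset_slice (r0 : R) (P : pred R) :
  #|[pred r in coset_class (\pi r0)%qT | P r]| = #|[pred n in N | P (r0 + n)]|.
Proof.
rewrite -[RHS](card_image (addrI r0)).
apply: eq_card => r; rewrite inE coset_classE; apply/andP/imageP => /=.
  move=> [rN rP]; exists (r - r0); last by rewrite addrC subrK.
  by rewrite !inE rN /= addrC subrK.
by move=> [n /andP [nN nP] ->]; rewrite addrAC subrr add0r.
Qed.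

Lemma card_coset_class (x : {ideal_quot N}) : #|coset_class x| = #|N|.
Proof.
rewrite -[x]reprK.
have eqT (A : {pred R}) : #|[pred r in A | predT r]| = #|A|.
  by apply: eq_card => r; rewrite inE andbT.
by rewrite -eqT card_coset_slice -(eqT N).
Qed.

(** A single coset element commuting with [a] suffices as a base point:
    translating by it preserves commutation with [a]. *)
Lemma leq_card_centralizer_coset (a : R) (x : {ideal_quot N}) :
  (#|[pred r in coset_class x | commutes a r]|
     <= #|[pred n in N | commutes a n]|)%N.
Proof.
have [/existsP [r0 /andP [/eqP <- ar0]] | none] :=
  boolP [exists r in coset_class x, commutes a r].
  rewrite card_coset_slice; apply/eq_leq/eq_card => n.
  by rewrite !inE commutesD.
rewrite eq_card0 // => r; apply: contraNF none => rP.
by apply/existsP; exists r.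
Qed.

(** The number of commuting pairs of [x * N] serves as an intermediate
    value: counting along [y] first and, after exchanging the two sides, along
    [x] replaces each coset by [N] in turn. *)
Lemma leq_card_comm_pairs_coset (x y : {ideal_quot N}) :
  (#|comm_pairs (coset_class x) (coset_class y)| <= #|comm_pairs N N|)%N.
Proof.
apply: (@leq_trans #|comm_pairs (coset_class x) N|).
  rewrite !card_comm_pairs leq_sum // => h _.
  exact: leq_card_centralizer_coset.
rewrite card_comm_pairsC !card_comm_pairs leq_sum // => n _.
exact: leq_card_centralizer_coset.
Qed.

(** The left-hand side is [|N| |N|], which is also the largest possible value
    of the right-hand side; so the previous inequality forces equality. *)
Lemma card_comm_pairs_coset (x y : {ideal_quot N}) :
    {in coset_class x & coset_class y, forall h r, commutes h r} ->
  #|comm_pairs (coset_class x) (coset_class y)| = #|comm_pairs N N|.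
Proof.
move=> xy; apply/eqP; rewrite eqn_leq leq_card_comm_pairs_coset.
have -> : #|comm_pairs (coset_class x) (coset_class y)| = (#|N| * #|N|)%N.
  rewrite -{1}(card_coset_class x) -(card_coset_class y) -cardX.
  apply: eq_card => -[h r]; rewrite [in LHS]inE [in RHS]inE /=.
  by case: (boolP (h \in _)) => // hx; case: (boolP (r \in _)) => // /(xy h r hx) ->.
rewrite -cardX subset_leq_card //; apply/subsetP => -[h r] /and3P [hN rN _].
by rewrite inE hN rN.
Qed.

(** The hypothesis says that [A] is the full preimage of [B]; it applies both
    to the subring [H] over [H/N] and to the whole ring over [R/N]. *)
Lemma card_saturated (A : {pred R}) (B : {pred {ideal_quot N}}) :
  (forall r, ((\pi r)%qT \in B) = (r \in A)) -> #|A| = (#|B| * #|N|)%N.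
Proof.
move=> satA; rewrite -sum1_card.
rewrite (partition_big (\pi_{ideal_quot N})%qT (mem B)) /=; last first.
  by move=> a; rewrite satA.
rewrite -sum_nat_const; apply: eq_bigr => x xB.
rewrite -(card_coset_class x) -sum1_card; apply: eq_bigl => r.
by rewrite -satA andb_idl // => /eqP ->.
Qed.

Lemma card_comm_pairs_saturated (A A' : {pred R}) (B B' : {pred {ideal_quot N}}) :
    (forall r, ((\pi r)%qT \in B) = (r \in A)) ->
    (forall r, ((\pi r)%qT \in B') = (r \in A')) ->
  #|comm_pairs A A'| =
  (\sum_(q in comm_pairs B B')
     #|comm_pairs (coset_class q.1) (coset_class q.2)|)%N.
Proof.
move=> satA satA'; rewrite -sum1_card.
rewrite (partition_big
  (fun p : R * R => (\pi p.1, \pi p.2)%qT : {ideal_quot N} * {ideal_quot N})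
  (mem (comm_pairs B B'))) /=; last first.
  move=> [h r] /and3P [/= hA rA' hr].
  rewrite !inE satA satA' hA rA' commutes_pi.
  by rewrite (eqP hr) subrr rpred0.
apply: eq_bigr => -[x y] /and3P [/= xB yB' _]; rewrite -sum1_card.
apply: eq_bigl => -[h r]; rewrite !inE xpair_eqE /= -satA -satA'.
have [-> | _] := eqVneq (\pi h)%qT x; last by rewrite !andbF.
have [-> | _] := eqVneq (\pi r)%qT y; last by rewrite !andbF.
by rewrite /= xB yB' !andbT.
Qed.

Lemma mem_rng_quot_image (H : zmodClosed R) (r : R) : {subset N <= H} ->
  ((\pi r)%qT \in rng_quot_image N H) = (r \in H).
Proof.
move=> sub_NH; apply/imsetP/idP => [[h hH /eqP] | rH]; last by exists r.
rewrite -Quotient.idealrBE => /sub_NH rhH.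
by rewrite -(subrK h r) rpredD.
Qed.

End Coset.

Theorem theorem2p13 (R : finRngType) (H : subrngClosed R) (N : rngIdeal R)
    (R_noncomm : exists x y : R, x ** y <> y ** x)
    (sub_NH : {subset N <= H}) :
  comm_prob H [set: R]
    <= comm_prob (rng_quot_image N H) [set: {ideal_quot N}] * comm_prob N N
  /\ ([set x in N] :&: rng_commutators H [set: R] = [set 0] ->
      comm_prob H [set: R]
        = comm_prob (rng_quot_image N H) [set: {ideal_quot N}] * comm_prob N N).
Proof.
have satH r := mem_rng_quot_image N H r sub_NH.
have satR (r : R) : ((\pi r)%qT \in [set: {ideal_quot N}]) = (r \in [set: R]).
  by rewrite !inE.
have prodE : comm_prob (rng_quot_image N H) [set: {ideal_quot N}] * comm_prob N N
  = (#|comm_pairs (rng_quot_image N H) [set: {ideal_quot N}]|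
       * #|comm_pairs N N|)%:R / (#|H| * #|[set: R]|)%:R.
  (* Lagrange turns the product of the two denominators into |H| |R|. *)
  rewrite /comm_prob mulf_div -!natrM mulnACA.
  by rewrite -(card_saturated _ _ _ satH) -(card_saturated _ _ _ satR).
rewrite prodE /comm_prob -[#|pred_of_simpl _|]/#|comm_pairs H [set: R]|.
rewrite (card_comm_pairs_saturated _ _ _ _ _ satH satR); split.
  rewrite ler_wpM2r ?invr_ge0 ?ler0n // ler_nat -sum_nat_const leq_sum // => q _.
  exact: leq_card_comm_pairs_coset.
move=> disj; congr (_%:R / _).
rewrite -sum_nat_const; apply: eq_bigr => -[x y] /and3P [/= xH _ xy].
apply: card_comm_pairs_coset => h r /eqP hx /eqP ry.
(* The commutator is in [H, R] as h is in H, and in N as x and y commute. *)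
rewrite /commutes -subr_eq0 -in_set1 -disj !inE -commutes_pi hx ry xy /=.
apply/mem_zmod_gen/imset2P; exists h r; rewrite ?inE //.
by rewrite -satH hx.
Qed.
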